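(* Let $m\geq 0$ be an integer. Let the premiums $\{X_n, n\geq 1\}$ and the claims $\{Y_n, n\geq 1\}$ be sequences of nonnegative, identically distributed, $m$-dependent random variables with finite expectations, and let the rates of interest $\{I_n, n\geq 1\}$ be a sequence of i.i.d. nonnegative random variables with finite expectations. Suppose that the sequences $\{X_n\}$, $\{Y_n\}$, $\{I_n\}$ are mutually independent. For $u\geq 0$ define the surplus process by $U_0=u$ and $$U_n=U_{n-1}(1+I_n)+X_n-Y_n,\quad n\geq 1,$$ and the ultimate ruin probability $\Psi(u)=\mathbb{P}\big(\bigcup_{n=1}^\infty \{U_n<0\}\big)$. If there exists a positive real number $R$ satisfying $$\mathbb{E}\Big(e^{R\left(Y_1-X_1\right)}\Big)\leq 1,$$ then $$\Psi(u)\leq (m+1)e^{-R\frac{u}{m+1}}\quad\text{for all } u>\frac{(m+1)\ln(m+1)}{R}.$$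
   Context: A sequence of random variables $\{X_n, n\geq 1\}$ is called $m$-dependent (for a fixed nonnegative integer $m$) if the $\sigma$-algebras $\sigma\{X_1,\dots,X_n\}$ and $\sigma\{X_{n+k},X_{n+k+1},\dots\}$ are independent for all $k\geq m+1$ and all $n\geq 1$. In particular, $0$-dependence is independence. *)

(* Defs.v *)
From HB Require Import structures.
From mathcomp Require Import all_boot all_order all_algebra.
From mathcomp Require Import all_classical all_reals all_analysis.
Set Implicit Arguments. Unset Strict Implicit. Unset Printing Implicit Defensive.
Import Order.TTheory GRing.Theory Num.Theory.
Local Open Scope classical_set_scope.
Local Open Scope ring_scope.

Section defs.
Context {d : measure_display} {T : measurableType d} {R : realType}.
Variable P : probability T R.

Definition sigma_gen (X : nat -> T -> R) (S : set nat) : set (set T) :=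
  <<s [set A | exists i, S i /\ exists B : set R, measurable B /\ A = X i @^-1` B] >>.

Definition indep2 (F G : set (set T)) : Prop :=
  forall A B, F A -> G B -> P (A `&` B) = (P A * P B)%E.

Definition indep3 (F G H : set (set T)) : Prop :=
  forall A B C, F A -> G B -> H C -> P (A `&` B `&` C) = (P A * P B * P C)%E.

(* sequences indexed by n >= 1 (index 0 is ignored) *)
Definition m_dependent (m : nat) (X : nat -> T -> R) : Prop :=
  forall n k, (1 <= n)%N -> (m.+1 <= k)%N ->
    indep2 (sigma_gen X [set i | (1 <= i <= n)%N])
           (sigma_gen X [set i | (n + k <= i)%N]).

Definition ident_distr (X : nat -> T -> R) : Prop :=
  forall n, (1 <= n)%N -> forall B : set R, measurable B ->
    P (X n @^-1` B) = P (X 1%N @^-1` B).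

Definition mutually_indep (X : nat -> T -> R) : Prop :=
  forall (J : seq nat) (A : nat -> set T), uniq J -> all (fun i => 1 <= i)%N J ->
    (forall i, i \in J -> sigma_gen X [set i] (A i)) ->
    P (\bigcap_(i in [set i | i \in J]) A i) = (\prod_(i <- J) P (A i))%E.

End defs.

Fixpoint surplus {T} {R : realType} (u : R) (X Y I : nat -> T -> R) (n : nat)
  (w : T) : R :=
  match n with
  | 0 => u
  | n'.+1 => surplus u X Y I n' w * (1 + I n'.+1 w) + X n'.+1 w - Y n'.+1 w
  end.

Definition ruin_prob {d} {T : measurableType d} {R : realType} (P : probability T R)
  (u : R) (X Y I : nat -> T -> R) : \bar R :=
  P (\bigcup_(n in [set n | (1 <= n)%N]) [set w | surplus u X Y I n w < 0]).

(* Main.v *)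
Require Import Defs.
From HB Require Import structures.
From mathcomp Require Import all_boot all_order all_algebra.
From mathcomp Require Import all_classical all_reals all_analysis.
From mathcomp Require Import measurable_realfun zify lra.
Import Order.TTheory GRing.Theory Num.Theory.
Local Open Scope classical_set_scope.
Local Open Scope ring_scope.

(** As long as the interest-free surplus [u - S_n], with [S_n] the sum of
    [Y_i - X_i] over [i <= n], stays nonnegative, it bounds [U_n] from below, so
    ruin forces [u < S_n] for some [n]. Splitting [S_n] along the residue classes
    of the index modulo [m + 1], one of the classes contributes more than
    [u / (m + 1)]. Along a single class the increments are i.i.d., hence
    [exp (r S)] is a supermartingale there; stopping the walk when it crosses
    [u / (m + 1)] and applying Markov's inequality bounds the crossing probability
    by [exp (- r u / (m + 1))]. Summing over the [m + 1] classes concludes. *)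

(** * Pathwise estimates: interest-free comparison and residue classes *)

(** By induction the surplus at time [n] dominates a nonnegative quantity, so the interest earned in
    the next period can only increase it. *)
Lemma surplus_ge_interest_free {T} {R : realType} (u : R) (X Y I : nat -> T -> R)
    (w : T) (n : nat) :
  (forall k, (1 <= k)%N -> 0 <= I k w) ->
  (forall k, (k <= n)%N -> \sum_(i < k) (Y i.+1 w - X i.+1 w) <= u) ->
  u - \sum_(i < n) (Y i.+1 w - X i.+1 w) <= surplus u X Y I n w.
Proof.
move=> I0; elim: n => [|n IH] Su; first by rewrite big_ord0 subr0.
have {}IH : u - \sum_(i < n) (Y i.+1 w - X i.+1 w) <= surplus u X Y I n w.
  by apply: IH => k kn; apply: Su; exact: leqW.
have U0 : 0 <= surplus u X Y I n w.
  by apply: le_trans IH; rewrite subr_ge0 Su.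
have UI : 0 <= surplus u X Y I n w * I n.+1 w by rewrite mulr_ge0 ?I0.
rewrite big_ord_recr /= mulrDr mulr1.
set s := \sum_(i < n) _ in IH *; lra.
Qed.

(** [L] counts the indices below [N] in class [j]. The two-sided bound strengthens the induction:
    when [N] itself lies in the class, it forces [N = j + L * M], the next term of the
    progression. *)
Lemma sum_residue_class {V : zmodType} (f : nat -> V) (M j N : nat) :
  (j < M)%N ->
  exists L, (N <= j + L * M < N + M)%N /\
    \sum_(k < N | (k %% M == j)%N) f k = \sum_(l < L) f (j + l * M)%N.
Proof.
move=> jM; elim: N => [|N [L [/andP[NL LN] E]]].
  by exists 0%N; rewrite mul0n addn0 !big_ord0.
have [e|ne] := eqVneq (N %% M)%N j; last first.
  exists L; split; last first.
    by rewrite big_mkcond big_ord_recr /= (negbTE ne) addr0 -big_mkcond.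
  have : N != (j + L * M)%N.
    by apply: contraNneq ne => ->; rewrite addnC modnMDl modn_small.
  by lia.
have NE : N = (j + L * M)%N.
  have := divn_eq N M; rewrite e => NE.
  suff -> : L = (N %/ M)%N by rewrite addnC.
  by nia.
exists L.+1; split; first by lia.
rewrite big_mkcond big_ord_recr /= e eqxx -big_mkcond /= E big_ord_recr /=.
by rewrite NE.
Qed.

(** Pigeonhole: if every class contributed at most [u / m.+1%:R], the whole sum would be at most
    [u]. *)
Lemma exists_large_residue_class {R : realFieldType} (f : nat -> R) (m N : nat) (u : R) :
  u < \sum_(k < N) f k ->
  exists2 j, (j < m.+1)%N & exists L, u / m.+1%:R < \sum_(l < L) f (j + l * m.+1)%N.
Proof.
move=> uf; apply: contrapT => H; move: uf; apply/negP; rewrite -leNgt.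
rewrite (partition_big (fun k : 'I_N => inord (k %% m.+1) : 'I_m.+1) predT)//=.
apply: (@le_trans _ _ (\sum_(j < m.+1) u / m.+1%:R)); last first.
  by rewrite sumr_const card_ord -[leLHS]mulr_natr divfK ?pnatr_eq0.
apply: ler_sum => j _.
have [L [_ E]] := sum_residue_class f m.+1 j N (ltn_ord j).
rewrite (eq_bigl (fun k : 'I_N => (k %% m.+1 == j)%N)); last first.
  by move=> k; rewrite -val_eqE /= inordK// ltn_mod.
rewrite E leNgt; apply/negP => ul; apply: H; exists j => //; by exists L.
Qed.

Lemma measurable_superlevel {d : measure_display} {T : measurableType d}
    {R : realType} (f : T -> R) (v : R) :
  measurable_fun setT f -> measurable [set w | v < f w].
Proof.
move=> mf; rewrite (_ : [set w | _] = f @^-1` `]v, +oo[).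
  by rewrite -[X in measurable X]setTI; exact: mf.
by apply/seteqP; split => w /=; rewrite in_itv/= andbT.
Qed.

(** * Independence of generated sigma-algebras and product expectations *)

Section independence.
Context {d : measure_display} {T : measurableType d} {R : realType}.
Variable P : probability T R.
Implicit Types F G C D : set (set T).

Lemma indep2_sym F G : indep2 P F G -> indep2 P G F.
Proof. by move=> FG A B GA FB; rewrite setIC FG// muleC. Qed.

Lemma indep2_sub F F' G G' : F `<=` F' -> G `<=` G' ->
  indep2 P F' G' -> indep2 P F G.
Proof. by move=> FF GG H A B /FF FA /GG GB; exact: H. Qed.

(** Dynkin's pi-lambda argument: for fixed [B] in [D], the measurable sets [A] satisfying the
    product rule form a Dynkin system containing the pi-system [C]. *)
Lemma indep2_g_sigma_algebral C D : setI_closed C -> C `<=` measurable ->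
  D `<=` measurable -> indep2 P C D -> indep2 P <<s C >> D.
Proof.
move=> CI Cm Dm CD A B + DB; move: A.
have mB := Dm _ DB.
have PB : P B \is a fin_num by exact: fin_num_measure.
have sC : <<s C >> `<=` measurable.
  by apply: smallest_sub => //; exact: sigma_algebra_measurable.
suff : <<s C >> `<=` [set A | measurable A /\ P (A `&` B) = (P A * P B)%E].
  by move=> H A /H[].
apply: lambda_system_subset => //.
- apply/dynkin_lambda_system; split.
  + by split => //; rewrite setTI probability_setT mul1e.
  + move=> A [mA AB]; split; first exact: measurableC.
    have mAB : measurable (A `&` B) by exact: measurableI.
    rewrite setIC -setDE measureD// ?ltey_eq ?PB//.
    transitivity (P B - P A * P B)%E; first by rewrite -AB (setIC A).
    by rewrite probability_setC// muleBl ?fin_num_adde_defr// mul1e.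
  + move=> F tF /all_and2[mF FB]; split; first exact: bigcup_measurable.
    rewrite setI_bigcupl !measure_bigcup//; last 2 first.
    * by move=> k _; exact: measurableI.
    * exact: trivIset_setIr.
    rewrite muleC -(fineK PB) -nneseriesZl//.
    by apply: eq_eseriesr => k _; rewrite fineK// muleC; exact: FB.
- by move=> A CA; split; [exact: Cm|exact: CD].
Qed.

Lemma indep2_g_sigma_algebra C D : setI_closed C -> setI_closed D ->
  C `<=` measurable -> D `<=` measurable ->
  indep2 P C D -> indep2 P <<s C >> <<s D >>.
Proof.
move=> CI DI Cm Dm CD; apply: indep2_g_sigma_algebral => //.
  by apply: smallest_sub => //; exact: sigma_algebra_measurable.
apply: indep2_sym; apply: indep2_g_sigma_algebral => //.
exact: indep2_sym.
Qed.

(** The law of [(Z, W)] agrees with the product of the marginal laws on rectangles, hence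
    everywhere; Tonelli then separates the integral. *)
Lemma indep2_expectationM F G (Z W : T -> R) :
  measurable_fun setT Z -> measurable_fun setT W ->
  (forall x, 0 <= Z x) -> (forall x, 0 <= W x) ->
  (forall B, measurable B -> F (Z @^-1` B)) ->
  (forall B, measurable B -> G (W @^-1` B)) ->
  indep2 P F G ->
  (\int[P]_x (Z x * W x)%:E = \int[P]_x (Z x)%:E * \int[P]_x (W x)%:E)%E.
Proof.
move=> mZ mW Z0 W0 FZ GW FG.
pose Zm : {mfun T >-> R} := HB.pack Z (isMeasurableFun.Build _ _ _ _ _ mZ).
pose Wm : {mfun T >-> R} := HB.pack W (isMeasurableFun.Build _ _ _ _ _ mW).
pose mu1 := distribution P Zm; pose mu2 := distribution P Wm.
have mZW : measurable_fun setT (fun x => (Z x, W x)) by exact: measurable_fun_pair.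
pose ZW : {mfun T >-> (R * R)%type} :=
  HB.pack (fun x => (Z x, W x)) (isMeasurableFun.Build _ _ _ _ _ mZW).
pose mu := distribution P ZW.
(* Absolute values make the integrand nonnegative on the whole plane, as Tonelli requires, without
   changing it on the values of [(Z, W)]. *)
pose f (p : R * R) : \bar R := (`|p.1| * `|p.2|)%:E.
have mf : measurable_fun [set: R * R] f.
  by apply/measurable_EFinP; apply: measurable_funM; exact: measurableT_comp.
have f0 p : (0 <= f p)%E by rewrite lee_fin mulr_ge0.
have mn : measurable_fun [set: R] (fun x : R => (`|x|)%:E).
  by apply/measurable_EFinP; exact: normr_measurable.
have nE (V : T -> R) : (forall x, 0 <= V x) -> measurable_fun setT V ->
    (\int[P]_x (V x)%:E = \int[pushforward P V]_x (`|x|)%:E)%E.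
  move=> V0 mV; rewrite ge0_integral_pushforward//.
  by rewrite preimage_setT; apply: eq_integral => x _ /=; rewrite ger0_norm.
transitivity (\int[mu]_p f p)%E.
  rewrite ge0_integral_pushforward//.
  by rewrite preimage_setT; apply: eq_integral => x _; rewrite /f /= !ger0_norm.
transitivity (\int[mu1 \x mu2]_p f p)%E.
  apply: eq_measure_integral => A mA _; apply/esym.
  apply: product_measure_unique => // A1 A2 mA1 mA2.
  rewrite /mu /mu1 /mu2 /distribution /= /pushforward.
  by rewrite -(FG _ _ (FZ _ mA1) (GW _ mA2)).
rewrite fubini_tonelli1//= /fubini_F /f /=.
under eq_integral => x _.
  under eq_integral do rewrite EFinM.
  rewrite ge0_integralZl_EFin//.
  over.
rewrite ge0_integralZr//.
- by rewrite -!nE.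
- by apply: integral_ge0 => x _; rewrite lee_fin.
Qed.

Lemma sigma_gen_sub (X : nat -> T -> R) S C :
  (forall i, S i -> measurable_fun setT (X i : g_sigma_algebraType C -> R)) ->
  sigma_gen X S `<=` <<s C >>.
Proof.
move=> mX; apply: smallest_sub; first exact: smallest_sigma_algebra.
move=> _ [i [Si [B [mB ->]]]].
by rewrite -[_ @^-1` _]setTI; exact: mX.
Qed.

Lemma sigma_gen_measurable (X : nat -> T -> R) S :
  (forall i, S i -> measurable_fun setT (X i)) -> sigma_gen X S `<=` measurable.
Proof.
move=> mX; apply: smallest_sub; first exact: sigma_algebra_measurable.
move=> _ [i [Si [B [mB ->]]]].
by rewrite -[_ @^-1` _]setTI; exact: mX.
Qed.

Lemma sigma_gen_preimage (X : nat -> T -> R) (S : set nat) i (B : set R) :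
  S i -> measurable B -> sigma_gen X S (X i @^-1` B).
Proof. by move=> Si mB; apply: sub_gen_smallest; exists i; split => //; exists B. Qed.

Lemma sigma_gen_preimage_comp (X : nat -> T -> R) (S : set nat) i (f : R -> R)
    (B : set R) :
  S i -> measurable_fun setT f -> measurable B ->
  sigma_gen X S ((fun w => f (X i w)) @^-1` B).
Proof.
move=> Si mf mB; apply: (@sigma_gen_preimage X S i (f @^-1` B)) => //.
by rewrite -[X in measurable X]setTI; exact: mf.
Qed.

End independence.

(** * Exponential supermartingale and maximal inequality *)

Section random_walk.
Context {d : measure_display} {T : measurableType d} {R : realType}.
Variable P : probability T R.

(** The walk freezes at its first value above [v], overshoot included, so a crossing remains visible
    at all later times. *)
Fixpoint stopped_walk {Omega : Type} (v : R) (xi : nat -> Omega -> R) (n : nat)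
    (w : Omega) : R :=
  match n with
  | 0 => 0
  | k.+1 => let V := stopped_walk v xi k w in if v < V then V else V + xi k w
  end.

(** The measurable space is arbitrary so that the lemma also applies to [T] with the sigma-algebra
    of the first [n] increments, where it says that the stopped walk is adapted. *)
Lemma measurable_stopped_walk d' (Omega : measurableType d') v
    (xi : nat -> Omega -> R) n :
  (forall i, (i < n)%N -> measurable_fun setT (xi i)) ->
  measurable_fun setT (stopped_walk v xi n).
Proof.
elim: n => [|n IH] mxi /=; first exact: measurable_cst.
have mV : measurable_fun setT (stopped_walk v xi n).
  by apply: IH => i /ltnW; exact: mxi.
apply: measurable_fun_ifT => //.
- exact: measurable_fun_ltr.
- by apply: measurable_funD => //; exact: mxi.
Qed.

Lemma stopped_walk_gt (xi : nat -> T -> R) (v : R) w n :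
  v < \sum_(i < n) xi i w -> v < stopped_walk v xi n w.
Proof.
(* Either the walk is already frozen above [v], or it has never been stopped and is still the
   partial sum. *)
suff [|->] : v < stopped_walk v xi n w \/
    stopped_walk v xi n w = \sum_(i < n) xi i w by [].
elim: n => [|n IH] /=; first by right; rewrite big_ord0.
case: ifPn => [|nV]; first by left.
by case: IH => [V|->]; [rewrite V in nV|right; rewrite big_ord_recr].
Qed.

Lemma stopped_walk_gtS n v (xi : nat -> T -> R) w :
  v < stopped_walk v xi n w -> v < stopped_walk v xi n.+1 w.
Proof. by move=> /= V; rewrite V. Qed.

Section maximal_inequality.
Variables (xi : nat -> T -> R) (r v : R).
Hypothesis mxi : forall n, measurable_fun setT (xi n).
Hypothesis ixi :
  forall n, indep2 P (sigma_gen xi [set i | (i < n)%N]) (sigma_gen xi [set n]).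
Hypothesis r0 : 0 < r.
Hypothesis exi : forall n, (\int[P]_w (expR (r * xi n w))%:E <= 1)%E.

Let V := stopped_walk v xi.
Let mV n : measurable_fun setT (V n).
Proof. exact: measurable_stopped_walk. Qed.

Lemma expectation_stopped_walk_le1 n : (\int[P]_w (expR (r * V n w))%:E <= 1)%E.
Proof.
have mexp : measurable_fun [set: R] (fun x => expR (r * x)).
  exact: measurableT_comp.
elim: n => [|n IH].
  rewrite /V /=; under eq_integral do rewrite mulr0 expR0.
  by rewrite integral_cst// mul1e; exact: probability_le1.
apply: le_trans IH.
pose g (x : R) := if v < x then expR (r * x) else 0.
pose h (x : R) := if v < x then 0 else expR (r * x).
have mg : measurable_fun setT g.
  by apply: measurable_fun_ifT => //; exact: measurable_fun_ltr.
have mh : measurable_fun setT h.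
  by apply: measurable_fun_ifT => //; exact: measurable_fun_ltr.
have g0 x : 0 <= g x by rewrite /g; case: ifP => // _; exact: expR_ge0.
have h0 x : 0 <= h x by rewrite /h; case: ifP => // _; exact: expR_ge0.
have mgV : measurable_fun setT (fun w => (g (V n w))%:E).
  exact/measurable_EFinP/measurableT_comp.
have mhV : measurable_fun setT (fun w => h (V n w)) by exact: measurableT_comp.
have mexi : measurable_fun setT (fun w => expR (r * xi n w)).
  exact: (measurableT_comp mexp).
have -> : (\int[P]_w (expR (r * V n.+1 w))%:E =
    \int[P]_w (g (V n w))%:E + \int[P]_w (h (V n w) * expR (r * xi n w))%:E)%E.
  rewrite -ge0_integralD//=; last 3 first.
  - by move=> w _; rewrite lee_fin.
  - by move=> w _; rewrite lee_fin mulr_ge0// expR_ge0.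
  - exact/measurable_EFinP/measurable_funM.
  apply: eq_integral => w _; rewrite /g /h /V /= -/(V n w) -EFinD.
  by case: ifP => _; rewrite ?mul0r ?addr0// add0r mulrDr expRD.
have -> : (\int[P]_w (expR (r * V n w))%:E =
    \int[P]_w (g (V n w))%:E + \int[P]_w (h (V n w))%:E)%E.
  rewrite -ge0_integralD//=; last 3 first.
  - by move=> w _; rewrite lee_fin.
  - by move=> w _; rewrite lee_fin.
  - exact/measurable_EFinP.
  apply: eq_integral => w _; rewrite /g /h -EFinD.
  by case: ifP => _; rewrite ?addr0 ?add0r.
apply: leeD2l.
rewrite (@indep2_expectationM _ _ _ P _ _ _ _ _ _ _ _ _ _ (ixi n))//.
- rewrite -[leRHS]mule1; apply: lee_wpmul2l => //.
  by apply: integral_ge0 => w _; rewrite lee_fin.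
- set C := [set A | exists i, [set i | (i < n)%N] i /\
      exists B : set R, measurable B /\ A = xi i @^-1` B].
  (* [V n] depends only on the increments before [n], so the independence hypothesis [ixi n] applies
     to it. *)
  have mVC : measurable_fun setT (V n : g_sigma_algebraType C -> R).
    apply: measurable_stopped_walk => i ilt _ B mB; rewrite setTI.
    exact: sigma_gen_preimage.
  move=> B mB; rewrite (_ : _ @^-1` _ = V n @^-1` (h @^-1` B))//.
  rewrite -[V n @^-1` _]setTI; apply: mVC => //.
  by rewrite -[h @^-1` _]setTI; exact: mh.
- move=> B mB.
  exact: (sigma_gen_preimage_comp xi _ n (fun x => expR (r * x)) B).
Qed.

(* Markov's inequality for [expR (r * V n)]. *)
Let stopped_walk_tail n : (P [set w | (v < V n w)%R] <= (expR (- r * v))%:E)%E.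
Proof.
have mE : measurable [set w | (v < V n w)%R] by exact: measurable_superlevel.
(* Writing 1 as [expR (r * v) * expR (- r * v)] on the left and cancelling the second factor leaves
   [expR (r * v)] times the probability, to be bounded by 1. *)
rewrite -[leLHS]mul1e -[1%E]/((1 : R)%:E) -(expR0 R) -(subrr (r * v)) expRD EFinM.
rewrite -mulNr muleAC -[leRHS]mul1e; apply: lee_wpmul2r.
  by rewrite lee_fin expR_ge0.
apply: le_trans (expectation_stopped_walk_le1 n).
have -> : P [set w | v < V n w] = (\int[P]_w (\1_[set w | (v < V n w)%R] w)%:E)%E.
  by rewrite integral_indic// setIT.
rewrite -ge0_integralZl_EFin//; last exact/measurable_EFinP/measurable_indic.
apply: ge0_le_integral => //.
- apply/measurable_EFinP; apply: measurable_funM => //; exact: measurable_indic.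
- by apply/measurable_EFinP/measurableT_comp => //; exact: measurable_funM.
move=> w _; rewrite -EFinM lee_fin indicE.
have [/set_mem /= Vw|_] := boolP (w \in _).
  by rewrite mulr1 ler_expR ler_pM2l// ltW.
by rewrite mulr0 expR_ge0.
Qed.

Lemma maximal_inequality :
  (P (\bigcup_n [set w | (v < \sum_(i < n) xi i w)%R]) <= (expR (- r * v))%:E)%E.
Proof.
have mS n : measurable [set w | (v < \sum_(i < n) xi i w)%R].
  exact/measurable_superlevel/measurable_sum.
have mE n : measurable [set w | (v < V n w)%R] by exact: measurable_superlevel.
apply: (@le_trans _ _ (P (\bigcup_n [set w | (v < V n w)%R]))).
  apply: le_measure; rewrite ?inE//; [exact: bigcup_measurable..|].
  by move=> w [n _ /=] S; exists n => //=; exact: stopped_walk_gt.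
(* Freezing makes these events increase with [n], so continuity from below carries the tail bound at
   each [n] over to the union. *)
have ndE : {homo (fun n => [set w | (v < V n w)%R]) : n k / (n <= k)%N >-> (n <= k)%O}.
  apply: homo_leq => [x||n]; [exact: lexx|exact: le_trans|].
  by apply/subsetPset => w; exact: stopped_walk_gtS.
have cv := nondecreasing_cvg_mu (mu := P) mE (bigcup_measurable (fun n _ => mE n)) ndE.
rewrite -(cvg_lim _ cv)//; apply: lime_le; first by apply/cvg_ex; eexists; exact: cv.
by apply: nearW => n; exact: stopped_walk_tail.
Qed.

End maximal_inequality.
End random_walk.

(** * Net claims along one residue class *)

Section net_claims.
Context {d : measure_display} {T : measurableType d} {R : realType}.
Variable P : probability T R.

Lemma eq_expectation_ident_distr (X : nat -> T -> R) n (f : R -> R) :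
  (1 <= n)%N -> (forall k, (1 <= k)%N -> measurable_fun setT (X k)) ->
  ident_distr P X -> measurable_fun setT f -> (forall x, 0 <= f x) ->
  (\int[P]_w (f (X n w))%:E = \int[P]_w (f (X 1%N w))%:E)%E.
Proof.
move=> n1 mX idX mf f0.
have E k : (1 <= k)%N ->
    (\int[P]_w (f (X k w))%:E = \int[pushforward P (X k)]_x (f x)%:E)%E.
  move=> k1; rewrite ge0_integral_pushforward ?preimage_setT//; first exact: mX.
  - exact/measurable_EFinP.
  - by move=> x _; rewrite lee_fin.
have m1 := mX _ (leqnn 1); have mn := mX _ n1.
pose X1 : {mfun T >-> R} := HB.pack (X 1%N) (isMeasurableFun.Build _ _ _ _ _ m1).
pose Xn : {mfun T >-> R} := HB.pack (X n) (isMeasurableFun.Build _ _ _ _ _ mn).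
rewrite !E//.
rewrite -[LHS]/(\int[distribution P Xn]_x (f x)%:E)%E.
rewrite -[RHS]/(\int[distribution P X1]_x (f x)%:E)%E.
by apply: eq_measure_integral => A mA _; exact: idX.
Qed.

Lemma g_sigma_algebra_setI_closed (C : set (set T)) : setI_closed <<s C >>.
Proof.
move=> A B CA CB.
exact: (@measurableI _ (g_sigma_algebraType C) A B).
Qed.

Lemma setI_closed_setI_image (F G : set (set T)) :
  setI_closed F -> setI_closed G -> setI_closed [set A `&` B | A in F & B in G].
Proof.
move=> FI GI _ _ [A1 FA1 [B1 GB1 <-]] [A2 FA2 [B2 GB2 <-]].
exists (A1 `&` A2); first exact: FI.
by exists (B1 `&` B2); [exact: GI|rewrite setIACA].
Qed.

(** Independence of [F] and [G] separates the four-fold intersection into an [F] part and a [G]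
    part; each then splits by its own hypothesis, and the factors are regrouped. *)
Lemma indep2_setI_image (F F1 F2 G G1 G2 : set (set T)) :
  setI_closed F -> F1 `<=` F -> F2 `<=` F ->
  setI_closed G -> G1 `<=` G -> G2 `<=` G ->
  indep2 P F G -> indep2 P F1 F2 -> indep2 P G1 G2 ->
  indep2 P [set A `&` B | A in F1 & B in G1] [set A `&` B | A in F2 & B in G2].
Proof.
move=> FI F1F F2F GI G1G G2G FG F12 G12.
move=> _ _ [A1 FA1 [B1 GB1 <-]] [A2 FA2 [B2 GB2 <-]].
have [{}F1F {}F2F] := (F1F _ FA1, F2F _ FA2).
have [{}G1G {}G2G] := (G1G _ GB1, G2G _ GB2).
rewrite setIACA (FG _ _ (FI _ _ F1F F2F) (GI _ _ G1G G2G)) F12// G12//.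
by rewrite (FG _ _ F1F G1G) (FG _ _ F2F G2G) muleACA.
Qed.

Lemma sigma_gen_subset (X : nat -> T -> R) (S S' : set nat) :
  S `<=` S' -> sigma_gen X S `<=` sigma_gen X S'.
Proof.
move=> SS; apply: smallest_sub; first exact: smallest_sigma_algebra.
by move=> _ [i [Si [B [mB ->]]]]; apply: sigma_gen_preimage => //; exact: SS.
Qed.

(** Successive indices of a class are [m.+1] apart, exactly the gap at which [m]-dependence gives
    independence of past and future, for premiums and for claims; independence between the two
    sequences makes this joint. *)
Lemma m_dependent_residue_indep m (X Y : nat -> T -> R) j n :
  (forall k, (1 <= k)%N -> measurable_fun setT (X k)) ->
  (forall k, (1 <= k)%N -> measurable_fun setT (Y k)) ->
  m_dependent P m X -> m_dependent P m Y ->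
  indep2 P (sigma_gen X [set k | (1 <= k)%N]) (sigma_gen Y [set k | (1 <= k)%N]) ->
  let xi k w := Y (j + k * m.+1).+1 w - X (j + k * m.+1).+1 w in
  indep2 P (sigma_gen xi [set i | (i < n)%N]) (sigma_gen xi [set n]).
Proof.
move=> mX mY dX dY XY xi.
have mxi k : measurable_fun setT (xi k).
  by apply: measurable_funB; [exact: mY|exact: mX].
case: n => [|n].
  (* Before the first increment there is no last past index to feed to [m_dependent]; the past is
     then generated by the empty family, which is trivially a pi-system. *)
  apply: indep2_g_sigma_algebral.
  - by move=> A B [i []].
  - by move=> A [i []].
  - exact: sigma_gen_measurable.
  - by move=> A B [i []].
(* [N] is the time of the last past increment; the new one occurs at [N + m.+1], the least element
   of [S2]. *)
pose N := (j + n * m.+1).+1.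
pose S1 := [set i | (1 <= i <= N)%N]; pose S2 := [set i | (N + m.+1 <= i)%N].
(* A pi-system generating the joint sigma-algebra of [X] and [Y] over [S]; taking one factor to be
   [setT] recovers the events of either sequence. *)
pose C S := [set A `&` B | A in sigma_gen X S & B in sigma_gen Y S].
have S1p : S1 `<=` [set k | (1 <= k)%N] by move=> k /= /andP[].
have S2p : S2 `<=` [set k | (1 <= k)%N] by move=> k; rewrite /S2 /N /=; lia.
have Cm S : S `<=` [set k | (1 <= k)%N] -> C S `<=` measurable.
  move=> Sp _ [A XA [B YB <-]]; apply: measurableI.
  - by apply: sigma_gen_measurable XA => i /Sp; exact: mX.
  - by apply: sigma_gen_measurable YB => i /Sp; exact: mY.
have CI S : setI_closed (C S).
  by apply: setI_closed_setI_image; exact: g_sigma_algebra_setI_closed.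
have mC S k : S (j + k * m.+1).+1 ->
    measurable_fun setT (xi k : g_sigma_algebraType (C S) -> R).
  move=> Sk.
  have mXC : measurable_fun setT
      (X (j + k * m.+1).+1 : g_sigma_algebraType (C S) -> R).
    move=> _ B mB; rewrite setTI; apply: sub_gen_smallest.
    exists (X (j + k * m.+1).+1 @^-1` B); first exact: sigma_gen_preimage.
    by exists setT; [exact: (@measurableT _ (g_sigma_algebraType _))|rewrite setIT].
  have mYC : measurable_fun setT
      (Y (j + k * m.+1).+1 : g_sigma_algebraType (C S) -> R).
    move=> _ B mB; rewrite setTI; apply: sub_gen_smallest.
    exists setT; first exact: (@measurableT _ (g_sigma_algebraType _)).
    by exists (Y (j + k * m.+1).+1 @^-1` B); [exact: sigma_gen_preimage|rewrite setTI].
  exact: measurable_funB.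
apply: (@indep2_sub _ _ _ P _ <<s C S1 >> _ <<s C S2 >>).
- apply: sigma_gen_sub => i /= ilt; apply: mC; rewrite /S1 /N /= ltnS.
  by rewrite leq_add2l leq_mul2r; lia.
- apply: sigma_gen_sub => i /= ->; apply: mC; rewrite /S2 /N /=; lia.
apply: indep2_g_sigma_algebra => //; [exact: Cm..|].
apply: (@indep2_setI_image (sigma_gen X [set k | (1 <= k)%N]) _ _
                          (sigma_gen Y [set k | (1 <= k)%N])) => //.
- exact: g_sigma_algebra_setI_closed.
- exact: sigma_gen_subset.
- exact: sigma_gen_subset.
- exact: g_sigma_algebra_setI_closed.
- exact: sigma_gen_subset.
- exact: sigma_gen_subset.
- exact: dX.
- exact: dY.
Qed.

(** Independence factors the expectation into one term in [X n] and one in [Y n], and each depends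
    only on a marginal law, which is the same for all [n]. *)
Lemma expectation_net_claim n (X Y : nat -> T -> R) (r : R) : (1 <= n)%N ->
  (forall k, (1 <= k)%N -> measurable_fun setT (X k)) ->
  (forall k, (1 <= k)%N -> measurable_fun setT (Y k)) ->
  ident_distr P X -> ident_distr P Y ->
  indep2 P (sigma_gen X [set k | (1 <= k)%N]) (sigma_gen Y [set k | (1 <= k)%N]) ->
  (\int[P]_w (expR (r * (Y n w - X n w)))%:E =
   \int[P]_w (expR (r * (Y 1%N w - X 1%N w)))%:E)%E.
Proof.
move=> n1 mX mY idX idY XY.
have mexp (a : R) : measurable_fun [set: R] (fun x => expR (a * x)).
  exact: measurableT_comp.
have E k : (1 <= k)%N -> (\int[P]_w (expR (r * (Y k w - X k w)))%:E =
    \int[P]_w (expR (- r * X k w))%:E * \int[P]_w (expR (r * Y k w))%:E)%E.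
  move=> k1; rewrite -(@indep2_expectationM _ _ _ P _ _ _ _ _ _ _ _ _ _ XY)//.
  - by apply: eq_integral => w _; rewrite mulrBr addrC -mulNr expRD.
  - exact/(measurableT_comp (mexp _))/mX.
  - exact/(measurableT_comp (mexp _))/mY.
  - move=> B mB.
    exact: (sigma_gen_preimage_comp X _ k (fun x => expR (- r * x)) B).
  - move=> B mB.
    exact: (sigma_gen_preimage_comp Y _ k (fun x => expR (r * x)) B).
rewrite (E _ n1) (E _ (leqnn 1)); congr (_ * _)%E.
- exact: (@eq_expectation_ident_distr X n (fun x => expR (- r * x))).
- exact: (@eq_expectation_ident_distr Y n (fun x => expR (r * x))).
Qed.

End net_claims.

(** * Ruin bound by union over the residue classes *)

Theorem theorem3p4 (d : measure_display) (T : measurableType d) (R : realType)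
  (P : probability T R) (m : nat) (X Y I : nat -> {RV P >-> R}) :
  (forall n, (1 <= n)%N -> forall w, 0 <= X n w) ->
  (forall n, (1 <= n)%N -> forall w, 0 <= Y n w) ->
  (forall n, (1 <= n)%N -> forall w, 0 <= I n w) ->
  ident_distr P (fun n => X n) -> ident_distr P (fun n => Y n) ->
  ident_distr P (fun n => I n) ->
  m_dependent P m (fun n => X n) -> m_dependent P m (fun n => Y n) ->
  mutually_indep P (fun n => I n) ->
  (forall n, (1 <= n)%N -> P.-integrable setT (EFin \o X n)) ->
  (forall n, (1 <= n)%N -> P.-integrable setT (EFin \o Y n)) ->
  (forall n, (1 <= n)%N -> P.-integrable setT (EFin \o I n)) ->
  indep3 P (sigma_gen (fun n => X n) [set n | (1 <= n)%N])
           (sigma_gen (fun n => Y n) [set n | (1 <= n)%N])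
           (sigma_gen (fun n => I n) [set n | (1 <= n)%N]) ->
  forall r : R, 0 < r ->
  (\int[P]_w (expR (r * (Y 1%N w - X 1%N w)))%:E <= 1)%E ->
  forall u : R, (m.+1%:R * ln (m.+1%:R)) / r < u ->
  (ruin_prob P u (fun n => X n) (fun n => Y n) (fun n => I n)
     <= (m.+1%:R * expR (- r * (u / m.+1%:R)))%:E)%E.
Proof.
move=> _ _ I0 idX idY _ dX dY _ _ _ _ XYI r r0 Er1 u _.
have XY : indep2 P (sigma_gen (fun n => X n) [set n | (1 <= n)%N])
                   (sigma_gen (fun n => Y n) [set n | (1 <= n)%N]).
  move=> A B XA YB; have := XYI A B setT XA YB.
  rewrite setIT probability_setT mule1; apply.
  exact: (@measurableT _ (g_sigma_algebraType _)).
(* Classes start at [j = 0] while premiums and claims are numbered from 1, hence the successor. *)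
pose xi j k w := Y (j + k * m.+1)%N.+1 w - X (j + k * m.+1)%N.+1 w.
pose E j := \bigcup_L [set w | u / m.+1%:R < \sum_(l < L) xi j l w].
have mxi j k : measurable_fun setT (xi j k) by exact: measurable_funB.
have mE j : measurable (E j).
  by apply: bigcup_measurable => L _; exact/measurable_superlevel/measurable_sum.
have PE j : (P (E j) <= (expR (- r * (u / m.+1%:R)))%:E)%E.
  apply: maximal_inequality => // [n|n].
  - exact: (m_dependent_residue_indep P m (fun n => X n) (fun n => Y n) j n).
  - by rewrite (@expectation_net_claim _ _ _ P _ (fun n => X n) (fun n => Y n)).
have mU n : measurable_fun setT
    (surplus u (fun n => X n) (fun n => Y n) (fun n => I n) n).
  elim: n => [|n IH] /=; first exact: measurable_cst.
  apply: measurable_funB => //; apply: measurable_funD => //.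
  by apply: measurable_funM => //; exact: measurable_funD.
apply: (@le_trans _ _ (P (\big[setU/set0]_(j < m.+1) E j))).
  apply: le_measure; rewrite ?inE.
  - apply: bigcup_measurable => n _.
    rewrite (_ : [set w | _] = surplus u (fun n => X n) (fun n => Y n)
      (fun n => I n) n @^-1` `]-oo, 0[); last first.
      by apply/seteqP; split => w /=; rewrite in_itv.
    by rewrite -[X in measurable X]setTI; exact: mU.
  - by apply: bigsetU_measurable => j _; exact: mE.
  move=> w [n _ /= Un].
  (* If no interest-free sum exceeded [u], the pathwise comparison would keep the surplus
     nonnegative at time [n], contradicting ruin. *)
  have [k uk] : exists k, u < \sum_(i < k) (Y i.+1 w - X i.+1 w).
    apply: contrapT => /forallNP H.
    move: Un; apply/negP; rewrite -leNgt.
    have Su k : \sum_(i < k) (Y i.+1 w - X i.+1 w) <= u.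
      by rewrite leNgt; apply/negP; exact: H.
    apply: le_trans (surplus_ge_interest_free u (fun n => X n) (fun n => Y n)
      (fun n => I n) w n (fun k k1 => I0 k k1 w) (fun k _ => Su k)).
    by rewrite subr_ge0.
  have [j jm [L uL]] := exists_large_residue_class
    (fun i => Y i.+1 w - X i.+1 w) m k u uk.
  rewrite -(bigcup_mkord m.+1 E).
  by exists j => //; exists L.
apply: (le_trans (Boole_inequality P (A := E) (n := m.+1) _)) => //.
apply: (@le_trans _ _ (\sum_(j < m.+1) (expR (- r * (u / m.+1%:R)))%:E)%E).
  by apply: lee_sum => j _; exact: PE.
by rewrite sumEFin sumr_const card_ord mulr_natl.
Qed.
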